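(* Let $n \ge 1$. The number of equivalence classes under $R$ on the set of decks that are permutations of the multiset $\{1^n,2^n\}$ is equal to the Catalan number $\frac{1}{n+2}\binom{2n+2}{n+1}$.
   Context: A deck here is a sequence of $2n$ labels containing exactly $n$ $1$'s and $n$ $2$'s (a permutation of the multiset $\{1^n,2^n\}$); there are $\binom{2n}{n}$ of them. For a finite sequence $\alpha$ of $1$'s and $2$'s, $|\alpha|$ denotes its length, and $\alpha^*$ denotes the sequence obtained by reversing the order of $\alpha$ and then replacing each $1$ by $2$ and each $2$ by $1$ (e.g. if $\alpha=1,2,2,2,1,1$ then $\alpha^*=2,2,1,1,1,2$). On the set of these decks, relate $\alpha\beta\gamma$ (concatenation) to $\alpha\beta^*\gamma$ whenever $|\alpha|=|\gamma|$ and the number of $1$'s in $\beta$ equals the number of $2$'s in $\beta$. $R$ is the equivalence relation obtained as the reflexive, transitive closure of this (symmetric) relation. *)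

(* Defs.v *)
From mathcomp Require Import all_boot.

Set Implicit Arguments.
Unset Strict Implicit.
Unset Printing Implicit Defensive.

(* Labels are booleans: [true] stands for the label 1, [false] for the
   label 2. *)
Definition label : finType := bool.
Definition one : label := true.
Definition two : label := false.

Definition is_deck (n : nat) (s : seq label) : bool :=
  perm_eq s (nseq n one ++ nseq n two).

(* The finite type of decks: arrangements of the multiset {1^n, 2^n}. *)
Definition deck (n : nat) : finType := {s : (2 * n).-tuple label | is_deck n s}.

Definition labels (n : nat) (d : deck n) : seq label := tval (val d).

Definition swap_label (x : label) : label := ~~ x.

Definition star (s : seq label) : seq label := map swap_label (rev s).

Definition balanced (s : seq label) : bool := count_mem one s == count_mem two s.

(* The lengths of alpha, beta and gamma are k, 2n - 2k and k, so that all
   quantifiers range over finite types; [stepP] removes these bounds. *)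
Definition step (n : nat) : rel (deck n) := fun d e =>
  [exists k : 'I_n.+1,
   exists a : k.-tuple label,
   exists b : (2 * n - 2 * k).-tuple label,
   exists c : k.-tuple label,
   [&& balanced b, labels d == a ++ b ++ c & labels e == a ++ star b ++ c]].

(* [connect] is the reflexive transitive closure. *)
Definition R (n : nat) : rel (deck n) := connect (@step n).

Definition R_classes (n : nat) : {set {set deck n}} :=
  equivalence_partition (@R n) [set: deck n].

Lemma stepP (n : nat) (d e : deck n) :
  reflect (exists a b c : seq label,
             [/\ size a = size c, balanced b,
                 labels d = a ++ b ++ c & labels e = a ++ star b ++ c])
          (step d e).
Proof.
apply: (iffP existsP) => [[k /existsP[a /existsP[b /existsP[c /and3P[hb /eqP hd /eqP he]]]]]|].
  by exists a, b, c; split; rewrite ?size_tuple.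
move=> [a [b [c [hs hb hd he]]]].
have hsz : size a + (size b + size a) = 2 * n.
  by rewrite {2}hs -!size_cat -hd size_tuple.
have hk : size a < n.+1.
  rewrite ltnS -(@leq_pmul2l 2) // -hsz mul2n -addnn leq_add2l.
  exact: leq_addl.
have hbs : size b == 2 * n - 2 * size a.
  by rewrite -hsz mul2n -addnn addnCA addnK.
have hcs : size c == size a by rewrite hs.
exists (Ordinal hk); apply/existsP; exists (in_tuple a).
apply/existsP; exists (Tuple hbs); apply/existsP; exists (Tuple hcs).
by rewrite /= hb hd he !eqxx.
Qed.

Lemma starK : involutive star.
Proof.
move=> s; rewrite /star -map_rev revK -map_comp -[RHS]map_id.
by apply: eq_map => x; rewrite /= /swap_label negbK.
Qed.

Lemma balanced_star (s : seq label) : balanced (star s) = balanced s.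
Proof.
rewrite /balanced /star !count_map !count_rev eq_sym.
by congr (_ == _); apply: eq_count; case.
Qed.

Lemma step_sym (n : nat) : symmetric (@step n).
Proof.
suff h (d e : deck n) : step d e -> step e d by move=> d e; apply/idP/idP; exact: h.
move=> /stepP[a [b [c [hs hb hd he]]]]; apply/stepP.
by exists a, (star b), c; rewrite balanced_star starK; split.
Qed.

Lemma R_equiv (n : nat) : equivalence_rel (@R n).
Proof.
apply/equivalence_relP; split=> [d|d e hde]; first exact: connect0.
exact: (same_connect (sym_connect_sym (@step_sym n))).
Qed.

(* Main.v *)
(* Read a deck from the outside in as a word of [n] pairs (i-th label, i-th
   label from the end). Starring the centre of the deck exchanges (1,1) and
   (2,2) in a suffix of the word and fixes (1,2) and (2,1). With (1,1) as an up
   step, (2,2) as a down step and the mixed pairs as level steps of two colours,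
   decks are two-coloured Motzkin bridges, and a permitted move reflects the
   part of the path after a visit to the axis. Each class thus contains exactly
   one nonnegative path, and these are counted by the reflection principle. *)
Require Import Defs.
From mathcomp Require Import all_boot all_order all_algebra.
From mathcomp Require Import zify.

Set Implicit Arguments.
Unset Strict Implicit.
Unset Printing Implicit Defensive.

Import Order.TTheory GRing.Theory Num.Theory.
Local Open Scope ring_scope.

(** * Folding decks into paths *)

Definition fold (n : nat) (s : seq label) : seq (label * label) :=
  zip (take n s) (rev (drop n s)).

Definition unfold (w : seq (label * label)) : seq label :=
  unzip1 w ++ rev (unzip2 w).

Definition flip (p : label * label) : label * label := (~~ p.2, ~~ p.1).

Definition rise (p : label * label) : int :=
  match p with
  | (true, true) => 1
  | (false, false) => -1
  | _ => 0
  end.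

Definition height (w : seq (label * label)) : int := \sum_(p <- w) rise p.

Lemma flipK : involutive flip.
Proof. by case=> [[] []]. Qed.

Lemma height_nil : height [::] = 0.
Proof. exact: big_nil. Qed.

Lemma height_cons p w : height (p :: w) = rise p + height w.
Proof. exact: big_cons. Qed.

Lemma height_cat u v : height (u ++ v) = height u + height v.
Proof. exact: big_cat. Qed.

Lemma height_flip w : height (map flip w) = - height w.
Proof.
rewrite /height big_map -sumrN.
by apply: eq_bigr => -[[] []] _.
Qed.

Lemma size_unfold w : size (unfold w) = (2 * size w)%N.
Proof. by rewrite size_cat size_rev !size_map mul2n addnn. Qed.

Lemma unfoldK w : fold (size w) (unfold w) = w.
Proof.
rewrite /fold /unfold take_size_cat ?size_map // drop_size_cat ?size_map //.
by rewrite revK zip_unzip.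
Qed.

Lemma foldK n s : size s = (2 * n)%N -> unfold (fold n s) = s.
Proof.
move=> hs.
have h1 : size (take n s) = n by rewrite size_takel // hs; lia.
have h2 : size (rev (drop n s)) = n by rewrite size_rev size_drop hs; lia.
by rewrite /unfold /fold unzip1_zip ?unzip2_zip ?h1 ?h2 // revK cat_take_drop.
Qed.

Lemma size_fold n s : size s = (2 * n)%N -> size (fold n s) = n.
Proof. by move=> /[dup] hs /foldK/(congr1 size); rewrite size_unfold hs; lia. Qed.

Lemma unfold_cat u v :
  unfold (u ++ v) = unzip1 u ++ unfold v ++ rev (unzip2 u).
Proof. by rewrite /unfold /unzip1 /unzip2 !map_cat rev_cat !catA. Qed.

Lemma star_unfold w : star (unfold w) = unfold (map flip w).
Proof.
by rewrite /star /unfold rev_cat revK map_cat map_rev /unzip1 /unzip2 -!map_comp.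
Qed.

(** A pair (1,1) has two more 1's than 2's, a pair (2,2) two fewer, and a mixed pair equally many:
    the excess is twice its [rise]. *)
Lemma count_unfold w :
  (count_mem Defs.one (unfold w))%:Z = (count_mem Defs.two (unfold w))%:Z + 2 * height w.
Proof.
rewrite /unfold !count_cat !count_rev.
elim: w => [|[x y] w IH]; first by rewrite height_nil.
rewrite height_cons; case: x y => [] [] /=.
(* The [set]s unify occurrences typed over [label] and over [bool], which
   [lia] would take for distinct atoms. *)
all: move: IH; set a := count _ (unzip1 w); set b := count _ (unzip2 w).
all: set c := count _ (unzip1 w); set d := count _ (unzip2 w); lia.
Qed.

Lemma balanced_unfold w : balanced (unfold w) = (height w == 0).
Proof. by rewrite /balanced; have := count_unfold w; lia. Qed.

Lemma is_deckE n s : is_deck n s = (size s == 2 * n)%N && balanced s.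
Proof.
have hc : (count_mem Defs.one s + count_mem Defs.two s)%N = size s.
  rewrite -(count_predC (pred1 Defs.one) s); congr addn.
  by apply: eq_count => -[].
apply/idP/idP => [hs|/andP[/eqP hs /eqP hb]].
  rewrite /balanced !(permP hs) (perm_size hs) size_cat !size_nseq.
  by rewrite !count_cat !count_nseq /=; lia.
rewrite /is_deck /perm_eq; apply/allP => x _ /=.
rewrite count_cat !count_nseq; apply/eqP.
have [ha hb'] : count_mem Defs.one s = n /\ count_mem Defs.two s = n by lia.
by case: x; [rewrite [LHS]ha|rewrite [LHS]hb'] => /=; lia.
Qed.

Section Decks.

Variable n : nat.
Implicit Types d e : deck n.

Definition word d := fold n (labels d).

Lemma size_labels d : size (labels d) = (2 * n)%N.
Proof. exact: size_tuple. Qed.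

Lemma unfold_word d : unfold (word d) = labels d.
Proof. exact/foldK/size_labels. Qed.

Lemma size_word d : size (word d) = n.
Proof. exact/size_fold/size_labels. Qed.

Lemma word_unfold d w : labels d = unfold w -> word d = w.
Proof.
move=> h; rewrite /word h -[RHS]unfoldK; congr fold.
by have := size_labels d; rewrite h size_unfold; lia.
Qed.

Lemma word_inj : injective word.
Proof.
move=> d e h; apply/val_inj/val_inj.
by rewrite -[LHS]unfold_word -[RHS]unfold_word h.
Qed.

Lemma height_word d : height (word d) = 0.
Proof.
apply/eqP; rewrite -balanced_unfold unfold_word.
by have := valP d; rewrite is_deckE => /andP[].
Qed.

Lemma word_surj w : size w = n -> height w = 0 -> exists d, word d = w.
Proof.
move=> hs hw.
have hsz : size (unfold w) == (2 * n)%N by rewrite size_unfold hs.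
have hd : is_deck n (Tuple hsz) by rewrite is_deckE hsz balanced_unfold hw eqxx.
by exists (exist _ (Tuple hsz) hd); apply: word_unfold.
Qed.

(** Because the outer blocks have equal length, they fold together into the prefix [u], and the
    centre folds into the suffix [v]. Balance of the centre is the condition that [v] has height
    0. *)
Lemma step_wordP d e :
  reflect (exists u v, [/\ word d = u ++ v, height v = 0
                         & word e = u ++ map flip v])
          (step d e).
Proof.
apply: (iffP (@stepP n d e)) => [[a [b [c [hs hb hd he]]]]|[u [v [hd hv he]]]].
  have hsb : size b = (2 * (n - size a))%N.
    by have := size_labels d; rewrite hd !size_cat -hs; lia.
  exists (zip a (rev c)), (fold (n - size a) b).
  have hac v : unfold (zip a (rev c) ++ v) = a ++ unfold v ++ c.
    by rewrite unfold_cat unzip1_zip ?unzip2_zip ?revK ?size_rev ?hs.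
  split.
  - by apply: word_unfold; rewrite hac foldK.
  - by apply/eqP; rewrite -balanced_unfold foldK.
  - by apply: word_unfold; rewrite hac -star_unfold foldK.
exists (unzip1 u), (unfold v), (rev (unzip2 u)); split.
- by rewrite size_rev !size_map.
- by rewrite balanced_unfold hv.
- by rewrite -unfold_word hd unfold_cat.
- by rewrite -unfold_word he unfold_cat star_unfold.
Qed.

End Decks.

(** * The nonnegative normal form of a path *)

(* Reflects the parts of the path [w], started at height [z], that lie below
   the axis; a step leaving the axis always ends up going upwards. *)
Fixpoint norm (z : int) (w : seq (label * label)) : seq (label * label) :=
  if w is p :: w' then
    (if (z < 0) || (z == 0) && (rise p < 0) then flip p else p)
      :: norm (z + rise p) w'
  else [::].

Lemma norm_cat z u v : norm z (u ++ v) = norm z u ++ norm (z + height u) v.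
Proof.
elim: u z => [|p u IH] z /=; first by rewrite height_nil addr0.
by rewrite IH height_cons addrA.
Qed.

Lemma size_norm z w : size (norm z w) = size w.
Proof. by elim: w z => //= p w IH z; rewrite IH. Qed.

(** Off the axis, exactly one of the two mirror paths is below it and gets flipped, so the results
    agree. On the axis the direction of the step decides, and [flip] reverses it. *)
Lemma norm_flip z w : norm (- z) (map flip w) = norm z w.
Proof.
elim: w z => //= p w IH z; rewrite -IH; congr (_ :: norm _ _); last first.
  by case: p => [[] []] /=; lia.
case: (ltgtP z 0) => hz; rewrite ?hz.
- have -> : (- z < 0) = false by lia.
  by have -> : (- z == 0) = false by lia.
- have -> : (- z < 0) by lia.
  by rewrite flipK.
- by rewrite oppr0; case: p => [[] []].
Qed.

Fixpoint motzkin (h : nat) (w : seq (label * label)) : bool :=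
  match w with
  | [::] => h == 0%N
  | (true, true) :: w' => motzkin h.+1 w'
  | (false, false) :: w' => if h is h'.+1 then motzkin h' w' else false
  | _ :: w' => motzkin h w'
  end.

Lemma motzkin_height h w : motzkin h w -> h%:Z + height w = 0.
Proof.
elim: w h => [|[x y] w IH] h /=; first by move/eqP->; rewrite height_nil.
rewrite height_cons; case: x y => [] [] /=; try by move/IH; lia.
by case: h => // h /IH; lia.
Qed.

Lemma norm_motzkin h w : motzkin h w -> norm h%:Z w = w.
Proof.
elim: w h => [|[x y] w IH] h //=.
case: x y => [] [] /= hw.
- rewrite andbF; congr (_ :: _).
  by rewrite -[RHS](IH _ hw); congr norm; lia.
- by rewrite andbF addr0 IH.
- by rewrite andbF addr0 IH.
- case: h hw => // h hw /=; congr (_ :: _).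
  by rewrite -[RHS](IH _ hw); congr norm; lia.
Qed.

(** By induction, the normalised path stands at the absolute value of the height of the original. *)
Lemma motzkin_norm (z : int) w : z + height w = 0 -> motzkin `|z| (norm z w).
Proof.
elim: w z => [|p w IH] z /=; first by rewrite height_nil; lia.
rewrite height_cons addrA => /IH.
case: (ltgtP z 0) => hz.
- case: p => [[] []] /=; rewrite ?addr0 //.
    by have -> : absz z = (absz (z + 1)).+1 by lia.
  by have -> : absz (z - 1) = (absz z).+1 by lia.
- case: p => [[] []] /=; rewrite ?addr0 //.
    by have -> : absz (z + 1) = (absz z).+1 by lia.
  by have -> : absz z = (absz (z - 1)).+1 by lia.
- by rewrite hz; case: p => [[] []].
Qed.

(** * One nonnegative path in each class *)

Section Classes.

Variable n : nat.
Implicit Types d e : deck n.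

(** The whole word and the reflected suffix both have height 0, hence so has the prefix. Thus [norm]
    meets the suffix on the axis, where it gives the same result for it and its mirror image. *)
Lemma norm_invariant d e : R d e -> norm 0 (word d) = norm 0 (word e).
Proof.
case/connectP => p; elim: p d => [|d' p IH] d /= => [_ ->//|].
case/andP=> /step_wordP[u [v [hd hv hd']]] hp he.
rewrite -(IH d') // hd hd' !norm_cat.
have hu : height u = 0 by have := height_word d; rewrite hd height_cat hv addr0.
by rewrite hu addr0 -(norm_flip 0 v) oppr0.
Qed.

(** Scans the word from left to right. When the next letter would leave the axis downwards, one move
    reflects the entire rest. This changes both the deck and [v] but not the length of [v], hence
    the induction on that length for all decks. *)
Lemma R_norm_suffix d u v :
  word d = u ++ v -> 0 <= height u ->
  exists2 e, R d e & word e = u ++ norm (height u) v.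
Proof.
have [m] := ubnP (size v); elim: m v d u => // m IH [|p v] d u hs hd hu.
  by exists d; [exact: connect0|].
have hup q : height (rcons u q) = height u + rise q.
  by rewrite -cats1 height_cat height_cons height_nil addr0.
have [/andP[/eqP hu0 hp]|hup0] := boolP ((height u == 0) && (rise p < 0)).
  have hpv : height (p :: v) = 0.
    by have := height_word d; rewrite hd height_cat hu0 add0r.
  have [||d' hd'] := @word_surj n (rcons u (flip p) ++ map flip v).
  - by rewrite -(size_word d) hd !size_cat size_rcons size_map /=; lia.
  - by rewrite cat_rcons height_cat hu0 add0r -map_cons height_flip hpv.
  have [||e he1 he2] := IH _ d' _ _ hd'; rewrite ?size_map //.
    by rewrite hup hu0; case: p hp {hs hpv hd' hd} => [[] []].
  exists e.
    apply: connect_trans he1; apply/connect1/step_wordP.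
    by exists u, (p :: v); rewrite hd' cat_rcons.
  rewrite he2 hup hu0 cat_rcons /= hp; congr (_ ++ _ :: _).
  (* The reflected rest starts at height 1, the original rest at height -1. *)
  rewrite -[RHS]norm_flip; congr norm.
  by case: p {hs hp hpv hd hd' he2} => [[] []].
have [|||e he1 he2] := IH v d (rcons u p) => //.
- by rewrite cat_rcons.
- by rewrite hup; case: p hup0 {hs hd} => [[] []] /=; lia.
exists e => //; rewrite he2 hup cat_rcons /=.
by rewrite (negbTE hup0) orbF ltNge hu.
Qed.

Lemma R_norm d : exists2 e, R d e & word e = norm 0 (word d).
Proof.
have [|e he1 he2] := @R_norm_suffix d [::] (word d) (erefl _).
  by rewrite height_nil.
by exists e; rewrite ?he2 ?height_nil.
Qed.

(** [cls] is a bijection from nonnegative decks to classes: injective since [norm] is constant on a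
    class and fixes nonnegative paths, surjective by [R_norm]. *)
Lemma card_R_classes :
  #|R_classes n| = #|[set d : deck n | motzkin 0 (word d)]|.
Proof.
have eqR := @R_equiv n.
pose cls d : {set deck n} := [set e in [set: deck n] | R d e].
rewrite -(card_in_imset (f := cls)) => [|d e]; last first.
  rewrite !inE => hd he /setP/(_ e); rewrite !inE (eqR e e e).1 /=.
  move/norm_invariant; rewrite !(@norm_motzkin 0) //; exact: word_inj.
congr #|pred_of_set _|; apply/setP => A; apply/imsetP/imsetP => -[d hd ->].
  have [e he1 he2] := R_norm d; exists e.
    by rewrite inE he2 (@motzkin_norm 0) // height_word.
  apply/setP => x; rewrite !inE /=.
  by rewrite ((eqR d e x).2 he1).
by exists d.
Qed.

End Classes.

(** * Counting nonnegative paths *)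

Fixpoint motzkin_words (n h : nat) : seq (seq (label * label)) :=
  if n is n'.+1 then
    map (cons (true, true)) (motzkin_words n' h.+1)
    ++ map (cons (true, false)) (motzkin_words n' h)
    ++ map (cons (false, true)) (motzkin_words n' h)
    ++ (if h is h'.+1 then map (cons (false, false)) (motzkin_words n' h')
        else [::])
  else if h is 0%N then [:: [::]] else [::].

Lemma mem_map_cons (T : eqType) (x y : T) s S :
  (x :: s \in map (cons y) S) = (x == y) && (s \in S).
Proof.
apply/mapP/andP => [[t ht [-> ->]]|[/eqP-> hs]]; first by rewrite eqxx.
by exists s.
Qed.

Lemma mem_motzkin_words n h w :
  (w \in motzkin_words n h) = (size w == n) && motzkin h w.
Proof.
elim: n h w => [|n IH] h [|p w]; rewrite /= ?mem_cat.
- by case: h.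
- by case: h.
- have hnil y S : ([::] \in map (cons y) S) = false.
    by apply/negP => /mapP[].
  by case: h => [|h]; rewrite ?mem_cat !hnil.
- by case: h => [|h]; rewrite !mem_map_cons ?IH eqSS;
    case: p => [[] []]; rewrite /= ?orbF ?andbF.
Qed.

Lemma motzkin_words_uniq n h : uniq (motzkin_words n h).
Proof.
elim: n h => [|n IH] h /=; first by case: h.
have inj (x : label * label) : injective (cons x) by move=> ? ? [].
have hn (x y : label * label) S S' : x != y ->
    has (mem (map (cons x) S)) (map (cons y) S') = false.
  move=> hxy; apply/negP => /hasP[_ /mapP[s _ ->]] /=.
  by rewrite mem_map_cons eq_sym (negbTE hxy).
by case: h => [|h]; rewrite !cat_uniq !has_cat !hn // !map_inj_uniq // !IH.
Qed.

(* The reflection principle: reading each letter as two unit steps, these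
   words are the nonnegative walks of length [2 n] from [2 h + 1] to [1]. *)
Lemma size_motzkin_words n h :
  (size (motzkin_words n h) + 'C(2 * n, n + h + 2) = 'C(2 * n, n + h))%N.
Proof.
elim: n h => [|n IH] h; first by case: h => [|h] //; rewrite !bin_small.
(* The weights 1, 2, 1 match the one up, two level and one down letters. *)
have pascal m k : 'C(m.+2, k.+2) = ('C(m, k.+2) + 2 * 'C(m, k.+1) + 'C(m, k))%N.
  by rewrite !binS; lia.
have -> : (2 * n.+1 = (2 * n).+2)%N by lia.
case: h => [|h] /=; rewrite ?cats0 !size_cat !size_map.
  have := IH 0%N; have := IH 1%N.
  have -> : (n.+1 + 0 + 2 = n.+1.+2)%N by lia.
  have -> : (n + 1 + 2 = n.+3)%N by lia.
  have -> : (n + 0 + 2 = n.+2)%N by lia.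
  (* At height 0 there is no down letter. By symmetry of the binomials, the term one below the
     middle equals the term one above it. *)
  have -> : 'C((2 * n).+2, n.+1 + 0) = (2 * 'C(2 * n, n) + 2 * 'C(2 * n, n.+1))%N.
    have : 'C((2 * n).+1, n) = 'C((2 * n).+1, n.+1).
      by rewrite -bin_sub; [congr binomial; lia|lia].
    by move=> h; rewrite addn0 binS h binS; lia.
  rewrite pascal addn0 addn1.
  set a := size (motzkin_words n 0); set b := size (motzkin_words n 1).
  lia.
have := IH h; have := IH h.+1; have := IH h.+2.
have -> : (n.+1 + h.+1 + 2 = (n + h).+2.+2)%N by lia.
have -> : (n.+1 + h.+1 = (n + h).+2)%N by lia.
have -> : (n + h.+2 + 2 = (n + h).+2.+2)%N by lia.
have -> : (n + h.+1 + 2 = (n + h).+3)%N by lia.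
have -> : (n + h + 2 = (n + h).+2)%N by lia.
rewrite !addnS !pascal.
set a := size (motzkin_words n h); set b := size (motzkin_words n h.+1).
set c := size (motzkin_words n h.+2); lia.
Qed.

Lemma ballot_catalan n : (0 < n)%N ->
  ((n + 2) * ('C(2 * n, n) - 'C(2 * n, n + 2)) = 'C(2 * n + 2, n + 1))%N.
Proof.
case: n => // n _.
have h1 := mul_bin_left (2 * n.+1) n.+1.
have h2 := mul_bin_left (2 * n.+1) n.+2.
have h3 : 'C((2 * n.+1).+1, n.+1) = 'C((2 * n.+1).+1, n.+2).
  by rewrite -bin_sub; [congr binomial; lia|lia].
rewrite !addn2 addn1 binS h3 binS.
have e1 : (2 * n.+1 - n.+1 = n.+1)%N by lia.
have e2 : (2 * n.+1 - n.+2 = n)%N by lia.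
rewrite e1 in h1; rewrite e2 in h2.
rewrite mulnBr.
set X := 'C(_, n.+1) in h1 *; set Y := 'C(_, n.+2) in h1 h2 *.
set Z := 'C(_, n.+3) in h2 *.
(* With m = n + 1, [h2] turns (m+2)Z into (m-1)Y, and [h1] says (m+1)Y = mX, so both sides equal 2X
   + 2Y. *)
nia.
Qed.

Lemma card_motzkin_decks n :
  #|[set d : deck n | motzkin 0 (word d)]| = size (motzkin_words n 0).
Proof.
rewrite cardE -(size_map (@word n)); apply/perm_size/uniq_perm.
- by rewrite (map_inj_uniq (@word_inj n)) enum_uniq.
- exact: motzkin_words_uniq.
move=> w; rewrite mem_motzkin_words; apply/mapP/andP => [[d]|[/eqP hs hw]].
  by rewrite mem_enum inE => hd ->; rewrite size_word.
have [|d hd] := word_surj hs; first by have := motzkin_height hw; rewrite add0r.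
by exists d; rewrite // mem_enum inE hd.
Qed.

Theorem theorem3p2 (n : nat) (hn : (1 <= n)%N) :
  #|R_classes n|%:R = (n + 2)%:R^-1 * 'C(2 * n + 2, n + 1)%:R :> rat.
Proof.
have hm := size_motzkin_words n 0; rewrite addn0 in hm.
rewrite card_R_classes card_motzkin_decks -(ballot_catalan hn) -hm addnK.
by rewrite natrM mulKf // pnatr_eq0 addn2.
Qed.
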